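(* Let $a\ne0$ and suppose that $f$ has the MLR property, i.e. $f(x_1-\eta_1)f(x_2-\eta_2)\ge f(x_1-\eta_2)f(x_2-\eta_1)$ whenever $x_1<x_2$ and $\eta_1<\eta_2$. Consider estimating $\theta_{(2)}$ by $\delta$ under the linex loss $W(\delta-\theta_{(2)})$ with $W(t)=e^{at}-at-1$, and let $$c_0=\frac1a\ln\int_{-\infty}^{\infty}e^{ax}f(x)\,dx,\qquad c(0,u)=\frac1a\ln H(u),\qquad H(u)=\frac{\int_{-\infty}^{\infty}e^{az}f(z-u)f(z)\,dz}{\int_{-\infty}^{\infty}f(z-u)f(z)\,dz},\quad u>0.$$ If $P_{\boldsymbol\theta}\left(c_0>\frac1a\ln H(U)\right)\ne0$ for some $\boldsymbol\theta\in\mathbb{R}^2$, then the estimator $\delta_{ST}(\mathbf X)=X_{(2)}-\min\{c_0,c(0,U)\}$ improves upon the estimator $\delta_{c_0}(\mathbf X)=X_{(2)}-c_0$.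
   Context: Setting: $f$ is a Lebesgue probability density on $\mathbb{R}$; $X_1,X_2$ are independent and $X_i$ has density $x\mapsto f(x-\theta_i)$, where $\boldsymbol\theta=(\theta_1,\theta_2)\in\mathbb{R}^2$ is unknown. Write $\theta_{(2)}=\max\{\theta_1,\theta_2\}$, $X_{(1)}=\min\{X_1,X_2\}$, $X_{(2)}=\max\{X_1,X_2\}$, $U=X_{(2)}-X_{(1)}$, $\mathbf X=(X_1,X_2)$. The risk of $\delta$ is $R(\boldsymbol\theta,\delta)=E_{\boldsymbol\theta}[W(\delta(\mathbf X)-\theta_{(2)})]$. Standing assumptions: all integrals involving the loss are finite (so the risks are finite), and $c(0,u)$ is well defined for every $u>0$ (in particular $\int f(z-u)f(z)\,dz>0$). ''$\delta'$ improves upon $\delta$'' means $R(\boldsymbol\theta,\delta')\le R(\boldsymbol\theta,\delta)$ for all $\boldsymbol\theta\in\mathbb{R}^2$, with strict inequality for some $\boldsymbol\theta$. *)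

(* Defs.v *)
From HB Require Import structures.
From mathcomp Require Import all_boot all_order all_algebra.
From mathcomp Require Import all_classical all_reals all_analysis.

Set Implicit Arguments.
Unset Strict Implicit.
Unset Printing Implicit Defensive.

Import Order.TTheory GRing.Theory Num.Theory.
Import numFieldNormedType.Exports.

Local Open Scope classical_set_scope.
Local Open Scope ring_scope.

Section defs.
Context {R : realType}.
Local Notation mu := (@lebesgue_measure R).

Definition is_prob_density (f : R -> R) : Prop :=
  [/\ measurable_fun setT f, forall x, 0 <= f x
    & (\int[mu]_x (f x)%:E = 1)%E].

Definition MLR (f : R -> R) : Prop :=
  forall x1 x2 eta1 eta2 : R, x1 < x2 -> eta1 < eta2 ->
    f (x1 - eta2) * f (x2 - eta1) <= f (x1 - eta1) * f (x2 - eta2).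

Definition linex (a t : R) : R := expR (a * t) - a * t - 1.

(* [Rintegral] is total, with junk values: [linex_c0], [linex_H] and
   [linex_c0u] are meaningful only together with [linex_loss_finite] and
   [linex_c0u_well_defined].  Only [linex_H a f u] with 0 < u matters: the
   event X1 = X2 is null under every parameter of a [location_model]. *)
Definition linex_c0 (a : R) (f : R -> R) : R :=
  a^-1 * ln (\int[mu]_x (expR (a * x) * f x)).

Definition linex_H (a : R) (f : R -> R) (u : R) : R :=
  (\int[mu]_z (expR (a * z) * f (z - u) * f z)) /
  (\int[mu]_z (f (z - u) * f z)).

Definition linex_c0u (a : R) (f : R -> R) (u : R) : R :=
  a^-1 * ln (linex_H a f u).

Definition linex_loss_finite (a : R) (f : R -> R) : Prop :=
  forall c : R, mu.-integrable setT (fun x => (linex a (x - c) * f x)%:E).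

Definition linex_c0u_well_defined (a : R) (f : R -> R) : Prop :=
  forall u : R, 0 < u ->
    [/\ mu.-integrable setT (fun z => (f (z - u) * f z)%:E),
        mu.-integrable setT (fun z => (expR (a * z) * f (z - u) * f z)%:E)
      & 0 < \int[mu]_z (f (z - u) * f z)].

Definition maxp (x : R * R) : R := Num.max x.1 x.2.
Definition minp (x : R * R) : R := Num.min x.1 x.2.
Definition spread (x : R * R) : R := maxp x - minp x.

Definition delta_c0 (a : R) (f : R -> R) (x : R * R) : R :=
  maxp x - linex_c0 a f.

Definition delta_ST (a : R) (f : R -> R) (x : R * R) : R :=
  maxp x - Num.min (linex_c0 a f) (linex_c0u a f (spread x)).

Section model.
Context {d : measure_display} {Omega : measurableType d}.

Definition has_density (P : probability Omega R) (X : {mfun Omega >-> R})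
    (g : R -> R) : Prop :=
  forall A : set R, measurable A ->
    (P (X @^-1` A) = \int[mu]_(x in A) (g x)%:E)%E.

Definition independent_RV (P : probability Omega R)
    (X Y : {mfun Omega >-> R}) : Prop :=
  forall A B : set R, measurable A -> measurable B ->
    (P (X @^-1` A `&` Y @^-1` B) = P (X @^-1` A) * P (Y @^-1` B))%E.

(* One sample space carrying the laws [P theta] for all parameters. *)
Definition location_model (f : R -> R) (P : R * R -> probability Omega R)
    (X1 X2 : {mfun Omega >-> R}) : Prop :=
  forall theta : R * R,
    [/\ independent_RV (P theta) X1 X2,
        has_density (P theta) X1 (fun x => f (x - theta.1))
      & has_density (P theta) X2 (fun x => f (x - theta.2))].

Definition risk (W : R -> R) (P : R * R -> probability Omega R)
    (X1 X2 : {mfun Omega >-> R}) (theta : R * R) (delta : R * R -> R) : \bar R :=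
  ('E_(P theta)[fun w => (W (delta (X1 w, X2 w) - maxp theta))%R])%E.

Definition improves_upon (W : R -> R) (P : R * R -> probability Omega R)
    (X1 X2 : {mfun Omega >-> R}) (delta' delta : R * R -> R) : Prop :=
  (forall theta,
     (risk W P X1 X2 theta delta' <= risk W P X1 X2 theta delta)%E) /\
  (exists theta,
     (risk W P X1 X2 theta delta' < risk W P X1 X2 theta delta)%E).

End model.
End defs.

(* Main.v *)
Require Import Defs.
From HB Require Import structures.
From mathcomp Require Import all_boot all_order all_algebra.
From mathcomp Require Import all_classical all_reals all_analysis.
From mathcomp Require Import measurable_realfun.
From mathcomp Require Import ring lra.
Import Order.TTheory GRing.Theory Num.Theory.
Import numFieldNormedType.Exports.
Local Open Scope classical_set_scope.
Local Open Scope ring_scope.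

(* Fix theta and write m = max theta, Z = max X - m, U = spread X. On {U = u > 0}
   the density g of Z satisfies, by MLR, g(y) w(z) <= g(z) w(y) for z <= y, where
   w(z) = f(z - u) f(z) is, up to a factor, the density of Z when the two
   parameters coincide. Hence E[e^(aZ) | U = u] <= H(u) if a > 0, with the reverse
   inequality if a < 0. If k = c(0, u) < c_0, then e^(ak) = H(u) and
     W(z - c_0) - W(z - k) - W(k - c_0) = (e^(az) - e^(ak)) (e^(-a c_0) - e^(-ak))
   show that replacing c_0 by k lowers the conditional risk by at least
   W(k - c_0) > 0. So the risk decreases for every theta, and strictly where
   {c(0, U) < c_0} has positive probability. *)

(** * Changes of variables and an association inequality for Lebesgue integrals *)

Section integration.
Local Open Scope ereal_scope.

(** A density is almost everywhere equal to the Radon-Nikodym derivative, since both have the same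
    integral over every measurable set; the change of variables known for the derivative therefore
    holds for [g]. *)
Lemma ge0_integral_density d (T : measurableType d) (R : realType)
    (nu : {finite_measure set T -> \bar R})
    (mu : {sigma_finite_measure set T -> \bar R}) (g : T -> R) :
    measurable_fun setT g -> (forall x, (0 <= g x)%R) ->
    (forall A, measurable A -> nu A = \int[mu]_(x in A) (g x)%:E) ->
  forall h : T -> \bar R, measurable_fun setT h -> (forall x, 0 <= h x) ->
  \int[nu]_x h x = \int[mu]_x (h x * (g x)%:E).
Proof.
move=> mg g0 nuE h mh h0.
have numu : nu `<< mu.
  apply/null_content_dominatesP => A mA muA0; rewrite nuE//.
  apply: null_set_integral => //.
  by apply/measurable_EFinP; exact: measurable_funTS.
pose F := Radon_Nikodym_SigmaFinite.f nu mu.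
have iF := Radon_Nikodym_SigmaFinite.f_integrable numu.
have Fg : ae_eq mu setT F (EFin \o g).
  apply: integral_ae_eq => //; first exact/measurable_EFinP.
  by move=> E _ mE; rewrite -nuE// -Radon_Nikodym_SigmaFinite.f_integral.
rewrite -(Radon_Nikodym_SigmaFinite.change_of_variables numu)//.
apply: ae_eq_integral => //.
- by apply: emeasurable_funM => //; exact: measurable_int iF.
- by apply: emeasurable_funM => //; exact/measurable_EFinP.
- exact: ae_eqe_mul2l.
Qed.

Context {R : realType}.
Notation mu := (@lebesgue_measure R).

Lemma ge0_integral_lebesgueN (h : R -> \bar R) :
    measurable_fun setT h -> (forall x, 0 <= h x) ->
  \int[mu]_x h (- x)%R = \int[mu]_x h x.
Proof.
move=> mh h0; transitivity (\int[pushforward mu (-%R : R -> measurableTypeR R)]_x h x).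
  by rewrite ge0_integral_pushforward.
by apply: eq_measure_integral => A mA _; exact: lebesgue_measureN.
Qed.

(** Translation preserves the length of half-open intervals, and Lebesgue measure is the only
    measure that extends this length. *)
Lemma lebesgue_measureD (c : R) (A : set R) : measurable A ->
  pushforward mu ((fun x => x + c)%R : R -> measurableTypeR R) A = mu A.
Proof.
pose shift : R -> measurableTypeR R := (fun x => x + c)%R.
have mshift : measurable_fun setT shift by exact: measurable_funD.
pose mfun_shift := isMeasurableFun.Build _ _ _ _ _ mshift.
pose mcP : {mfun R >-> measurableTypeR R} := HB.pack shift mfun_shift.
move=> mA; apply/esym/(@lebesgue_measure_unique _ (pushforward mu mcP)) => //=.
move=> _ [[a b]] _ <-.
rewrite /pushforward.
rewrite (_ : _ @^-1` _ = `](a - c)%R, (b - c)%R]%classic); last first.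
  by apply/seteqP; split=> x /=; rewrite !in_itv/= ltrBlDr lerBrDr.
rewrite !lebesgue_measure_itv/= !lte_fin ltrD2r; case: ifPn => // _.
by rewrite -!EFinB; congr EFin; ring.
Qed.

Lemma ge0_integral_lebesgueD (c : R) (h : R -> \bar R) :
    measurable_fun setT h -> (forall x, 0 <= h x) ->
  \int[mu]_x h (x + c)%R = \int[mu]_x h x.
Proof.
move=> mh h0.
transitivity (\int[pushforward mu ((fun x => x + c)%R : R -> measurableTypeR R)]_x h x).
  by rewrite ge0_integral_pushforward//; exact: measurable_funD.
apply: eq_measure_integral => [|mshift A mA _]; first exact: measurable_funD.
exact: (@lebesgue_measureD c A mA).
Qed.

(** This is the passage to the coordinates maximum [z] and gap [u]. The two summands come from the
    half-planes below and above the diagonal. *)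
Lemma ge0_integral_plane_max_gap (k : R * R -> \bar R) :
    measurable_fun setT k -> (forall x, 0 <= k x) ->
  \int[mu]_x \int[mu]_y k (x, y) =
  \int[mu]_(u in `]0%R, +oo[) \int[mu]_z (k (z, z - u)%R + k (z - u, z)%R).
Proof.
move=> mk k0.
have mk1 (x : R) : measurable_fun setT (fun y => k (x, y)).
  exact: measurableT_comp.
have mku : measurable_fun setT (fun zu : R * R => k (zu.1, zu.1 - zu.2)%R).
  apply: measurableT_comp => //; apply: measurable_fun_pair => //.
  exact: measurable_funB.
have mku' : measurable_fun setT (fun zu : R * R => k (zu.1 - zu.2, zu.1)%R).
  apply: measurableT_comp => //; apply: measurable_fun_pair => //.
  exact: measurable_funB.
(* The integral along the line [x - y = u], for [u] of either sign. *)
pose K (u : R) : \bar R := \int[mu]_z k (z, z - u)%R.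
have mK : measurable_fun setT K.
  exact: (@measurable_fun_fubini_tonelli_G _ _ _ _ _ mu _ mku).
have K0 u : 0 <= K u by exact: integral_ge0.
transitivity (\int[mu]_u K u).
  (* For fixed [x], the substitution [y = x - u] is a translation followed by a reflection. *)
  rewrite -(@fubini_tonelli _ _ _ _ _ mu mu _ mku)//.
  apply: eq_integral => x _ /=.
  rewrite -(ge0_integral_lebesgueD x)//.
  rewrite -(ge0_integral_lebesgueN (fun y => k (x, y + x)%R))//.
    by apply: eq_integral => u _; rewrite addrC.
  by apply: (measurableT_comp (mk1 x)); exact: measurable_funD.
have splitR : [set: R] = `]-oo, 0%R] `|` `]0%R, +oo[.
  apply/seteqP; split=> x //= _; rewrite !in_itv/= andbT.
  by case: (leP x 0%R); [left|right].
rewrite [in LHS]splitR ge0_integral_setU//=; last 2 first.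
  exact: measurable_funTS.
  apply/disj_setPS => x /= []; rewrite !in_itv/= andbT => x0.
  by rewrite ltNge x0.
(* Reflection moves the half-line of nonpositive gaps to the positive one; the point 0 is null. *)
have -> : \int[mu]_(u in `]-oo, 0%R]) K u = \int[mu]_(u in `]0%R, +oo[) K (- u)%R.
  under eq_integral do rewrite -[x in K x]opprK.
  rewrite -(@ge0_integration_by_substitution0 _ (fun u => K (- u)%R))//.
    rewrite integral_itv_obnd_cbnd//.
    by apply: measurable_funTS; exact: measurableT_comp.
  exact: measurableT_comp.
rewrite addeC -ge0_integralD//; last 2 first.
- exact: measurable_funTS.
- by apply: measurable_funTS; exact: measurableT_comp.
apply: eq_integral => u _.
rewrite ge0_integralD//; last 2 first.
- exact: measurableT_comp mku (pair2_measurable _).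
- exact: measurableT_comp mku' (pair2_measurable _).
congr (_ + _); rewrite /K.
(* Translating [z] by [u] makes the maximum, rather than the minimum, the coordinate of the second
   half-plane. *)
rewrite -[RHS](ge0_integral_lebesgueD u)//; last first.
  exact: measurableT_comp mku' (pair2_measurable _).
by apply: eq_integral => z _; rewrite addrK opprK.
Qed.

(* Chebyshev's association argument: integrate the pointwise hypothesis over the
   plane. In \bar R, Tonelli makes integrability assumptions superfluous. *)
Lemma le_integral_cross_product (phi g w : R -> R) :
    measurable_fun setT phi -> measurable_fun setT g -> measurable_fun setT w ->
    (forall x, (0 <= phi x)%R) -> (forall x, (0 <= g x)%R) ->
    (forall x, (0 <= w x)%R) ->
    (forall y z, ((phi y - phi z) * (g y * w z - g z * w y) <= 0)%R) ->
  \int[mu]_x (phi x * g x)%:E * \int[mu]_x (w x)%:E <=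
  \int[mu]_x (phi x * w x)%:E * \int[mu]_x (g x)%:E.
Proof.
move=> mphi mg mw phi0 g0 w0 cross.
have I0 (h : R -> R) : (forall x, (0 <= h x)%R) -> 0 <= \int[mu]_x (h x)%:E.
  by move=> h0; apply: integral_ge0 => x _; rewrite lee_fin.
have ME (h : R -> R) : measurable_fun setT h -> measurable_fun setT (EFin \o h).
  by move=> ?; exact/measurable_EFinP.
have prodE (h k : R -> R) : measurable_fun setT h -> measurable_fun setT k ->
    (forall x, (0 <= h x)%R) -> (forall x, (0 <= k x)%R) ->
    \int[mu]_y \int[mu]_z (h y * k z)%:E =
    \int[mu]_x (h x)%:E * \int[mu]_x (k x)%:E.
  move=> mh mk h0 k0.
  rewrite -ge0_integralZr//; last 3 first.
  - exact: ME.
  - by move=> x _; rewrite lee_fin.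
  - exact: I0.
  apply: eq_integral => y _; rewrite -ge0_integralZl//.
  - exact: ME.
  - by move=> x _; rewrite lee_fin.
  - by rewrite lee_fin.
have mpg : measurable_fun setT (fun x => phi x * g x)%R by exact: measurable_funM.
have mpw : measurable_fun setT (fun x => phi x * w x)%R by exact: measurable_funM.
have pg0 x : (0 <= phi x * g x)%R by rewrite mulr_ge0.
have pw0 x : (0 <= phi x * w x)%R by rewrite mulr_ge0.
have sumE (h k l m : R -> R) : measurable_fun setT h -> measurable_fun setT k ->
    measurable_fun setT l -> measurable_fun setT m ->
    (forall x, (0 <= h x)%R) -> (forall x, (0 <= k x)%R) ->
    (forall x, (0 <= l x)%R) -> (forall x, (0 <= m x)%R) ->
    \int[mu]_y \int[mu]_z (h y * k z + l y * m z)%:E =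
    \int[mu]_x (h x)%:E * \int[mu]_x (k x)%:E +
    \int[mu]_x (l x)%:E * \int[mu]_x (m x)%:E.
  move=> mh mk ml mm h0 k0 l0 m0.
  have mI (a b : R -> R) : measurable_fun setT a -> measurable_fun setT b ->
      (forall x, (0 <= a x)%R) -> (forall x, (0 <= b x)%R) ->
      measurable_fun setT (fun y => \int[mu]_z (a y * b z)%:E).
    move=> ma mb a0 b0.
    apply: (@measurable_fun_fubini_tonelli_F _ _ _ _ _ mu
      (fun yz : R * R => (a yz.1 * b yz.2)%:E)) => //=.
      apply/measurable_EFinP; apply: measurable_funM; exact: measurableT_comp.
    by move=> x; rewrite lee_fin mulr_ge0.
  rewrite -prodE// -prodE// -ge0_integralD//; last 4 first.
  - by move=> y _; apply: I0 => z; rewrite mulr_ge0.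
  - exact: mI.
  - by move=> y _; apply: I0 => z; rewrite mulr_ge0.
  - exact: mI.
  apply: eq_integral => y _.
  rewrite -ge0_integralD//.
  - by move=> z _; rewrite lee_fin mulr_ge0.
  - by apply: ME; exact: measurable_funM.
  - by move=> z _; rewrite lee_fin mulr_ge0.
  - by apply: ME; exact: measurable_funM.
set A := _ * _; set B := _ * _.
(* Symmetrization: the factors of one copy of each product are exchanged, so that the integrands on
   the two sides differ by exactly the expression in [cross]. *)
have AB : A + A <= B + B.
  rewrite {2}/A {2}/B muleC [X in _ <= _ + X]muleC /A /B -!sumE//.
  apply: ge0_le_integral => //.
  - by move=> y _; apply: I0 => z; rewrite addr_ge0 ?mulr_ge0.
  - apply: (@measurable_fun_fubini_tonelli_F _ _ _ _ _ mu (fun yz : R * R =>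
      (phi yz.1 * g yz.1 * w yz.2 + w yz.1 * (phi yz.2 * g yz.2))%:E)) => /=.
      apply/measurable_EFinP; apply: measurable_funD; apply: measurable_funM;
        by [exact: measurableT_comp|exact: (measurableT_comp mpg)].
    by move=> x; rewrite lee_fin addr_ge0 ?mulr_ge0.
  - apply: (@measurable_fun_fubini_tonelli_F _ _ _ _ _ mu (fun yz : R * R =>
      (phi yz.1 * w yz.1 * g yz.2 + g yz.1 * (phi yz.2 * w yz.2))%:E)) => /=.
      apply/measurable_EFinP; apply: measurable_funD; apply: measurable_funM;
        by [exact: measurableT_comp|exact: (measurableT_comp mpw)].
    by move=> x; rewrite lee_fin addr_ge0 ?mulr_ge0.
  move=> y _; apply: ge0_le_integral => //.
  - by move=> z _; rewrite lee_fin addr_ge0 ?mulr_ge0.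
  - by apply: ME; apply: measurable_funD; exact: measurable_funM.
  - by apply: ME; apply: measurable_funD; exact: measurable_funM.
  move=> z _; rewrite lee_fin -subr_le0; move: (cross y z); congr (_ <= 0)%R.
  ring.
have A0 : 0 <= A by rewrite mule_ge0 ?I0.
have B0 : 0 <= B by rewrite mule_ge0 ?I0.
(* Halving is immediate for finite values; if [A] is infinite, then so is [B]. *)
case: A B A0 B0 AB => [A| |] [B| |]//=; rewrite ?lee_fin ?leey// => A0 B0.
by move=> ?; lra.
Qed.

End integration.

(** * Linex loss and the conditional risk given the spread *)

Section linex_estimation.
Context {R : realType}.
Notation mu := (@lebesgue_measure R).
Implicit Types (f : R -> R) (a c p q u z : R).

Lemma linex_ge0 a z : 0 <= linex a z.
Proof. by rewrite /linex -addrA -opprD subr_ge0 addrC expR_ge1Dx. Qed.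

Lemma linex_gt0 a z : a != 0 -> z != 0 -> 0 < linex a z.
Proof.
move=> a0 z0; rewrite /linex -addrA -opprD subr_gt0 addrC.
by rewrite expR_gt1Dx// mulf_neq0.
Qed.

Lemma measurable_linex d (T : measurableType d) a (h : T -> R) :
  measurable_fun setT h -> measurable_fun setT (fun x => linex a (h x)).
Proof.
move=> mh; have mah : measurable_fun setT (fun x => a * h x).
  exact: measurable_funM.
rewrite /linex; apply: measurable_funB => //; apply: measurable_funB => //.
exact: measurableT_comp.
Qed.

(* Joint density of (max X - theta_(2), spread X) at (z, u), for
   p = theta_(2) - theta_1 and q = theta_(2) - theta_2. *)
Definition max_gap_density f p q z u : R :=
  f (z + p) * f (z - u + q) + f (z - u + p) * f (z + q).

Lemma max_gap_density_ge0 f p q z u :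
  (forall x, 0 <= f x) -> 0 <= max_gap_density f p q z u.
Proof. by move=> f0; rewrite addr_ge0 ?mulr_ge0. Qed.

Lemma measurable_max_gap_density f p q : measurable_fun setT f ->
  measurable_fun setT (fun zu : R * R => max_gap_density f p q zu.1 zu.2).
Proof.
move=> mf; apply: measurable_funD; apply: measurable_funM;
  apply: (measurableT_comp mf); apply: measurable_funD => //;
  exact: measurable_funB.
Qed.

(** MLR with shifts [- p] and 0. As MLR concerns strict inequalities only, the cases [z = y] and
    [p = 0] are treated apart; both are equalities. *)
Lemma MLR_shift f p y z : MLR f -> z <= y -> 0 <= p ->
  f (y + p) * f z <= f (z + p) * f y.
Proof.
move=> fMLR; rewrite le_eqVlt => /predU1P[->//|zy].
rewrite le_eqVlt => /predU1P[<-|p0]; first by rewrite !addr0 mulrC.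
have := fMLR z y (- p) 0 zy; rewrite oppr_lt0 => /(_ p0).
by rewrite !opprK !subr0 mulrC.
Qed.

Lemma MLR_max_gap_density f p q u y z : (forall x, 0 <= f x) -> MLR f ->
  0 <= p -> 0 <= q -> z <= y ->
  max_gap_density f p q y u * (f (z - u) * f z) <=
  max_gap_density f p q z u * (f (y - u) * f y).
Proof.
move=> f0 fMLR p0 q0 zy; have zyu : z - u <= y - u by rewrite lerB.
(* Each of the two summands of the density is handled by multiplying two instances of [MLR_shift],
   one at [z], [y] and one at [z - u], [y - u]. *)
have := ler_pM (mulr_ge0 (f0 _) (f0 _)) (mulr_ge0 (f0 _) (f0 _))
  (MLR_shift _ _ _ _ fMLR zy p0) (MLR_shift _ _ _ _ fMLR zyu q0).
have := ler_pM (mulr_ge0 (f0 _) (f0 _)) (mulr_ge0 (f0 _) (f0 _))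
  (MLR_shift _ _ _ _ fMLR zyu p0) (MLR_shift _ _ _ _ fMLR zy q0).
rewrite /max_gap_density; lra.
Qed.


Lemma measurable_linex_H a f : is_prob_density f ->
  measurable_fun setT (linex_H a f).
Proof.
move=> [mf f0 _].
have mff : measurable_fun setT (fun zu : R * R => f (zu.1 - zu.2) * f zu.1).
  apply: measurable_funM; last exact: measurableT_comp.
  by apply: (measurableT_comp mf); exact: measurable_funB.
have meff : measurable_fun setT
    (fun zu : R * R => expR (a * zu.1) * f (zu.1 - zu.2) * f zu.1).
  under eq_fun do rewrite -mulrA; apply: measurable_funM => //.
  by apply: measurableT_comp => //; exact: measurable_funM.
have mI (h : R * R -> R) : measurable_fun setT h -> (forall x, 0 <= h x) ->
    measurable_fun setT (fun u => \int[mu]_z h (z, u)).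
  move=> mh h0; rewrite /Rintegral; apply: measurableT_comp => //.
  apply: (@measurable_fun_fubini_tonelli_G _ _ _ _ _ mu (EFin \o h)) => //.
    exact/measurable_EFinP.
rewrite /linex_H; apply: measurable_funM.
  by apply: (mI _ meff) => x; rewrite !mulr_ge0 ?expR_ge0.
(* The reciprocal is written as a power, whose measurability is known; for a nonnegative base the
   two agree, even at 0. *)
rewrite (_ : (fun u => _) = fun u => (\int[mu]_z (f (z - u) * f z)) `^ (-1)).
  apply: (measurableT_comp (measurable_powR _)).
  by apply: (mI _ mff) => x; rewrite mulr_ge0.
apply/funext => u; rewrite powR_inv1// Rintegral_ge0// => z _.
by rewrite mulr_ge0.
Qed.

Lemma measurable_linex_c0u a f : is_prob_density f ->
  measurable_fun setT (linex_c0u a f).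
Proof.
move=> /(measurable_linex_H a) mH; rewrite /linex_c0u.
by apply: measurable_funM => //; exact: measurableT_comp.
Qed.

(** If the numerator vanished, so would its integrand almost everywhere. The exponential being
    positive, the denominator would then be 0 too. *)
Lemma linex_H_gt0 a f u : is_prob_density f -> linex_c0u_well_defined a f ->
  0 < u -> 0 < linex_H a f u.
Proof.
move=> [mf f0 _] wd u0; have [iw iew D0] := wd u u0.
rewrite /linex_H divr_gt0// lt0r Rintegral_ge0 ?andbT; last first.
  by move=> z _; rewrite !mulr_ge0 ?expR_ge0.
apply/eqP => N0; move: D0; rewrite ltNge => /negP; apply.
have /ae_eq_integral_abs h : (\int[mu]_z `|(expR (a * z) * f (z - u) * f z)%:E| = 0)%E.
  under eq_integral do rewrite gee0_abs ?lee_fin ?mulr_ge0 ?expR_ge0//.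
  by rewrite -[LHS]fineK ?integrable_fin_num//; congr EFin.
have {}h := h measurableT (measurable_int _ iew).
rewrite /Rintegral (ae_eq_integral (cst 0%E)) ?integral0//.
- exact: measurable_int iw.
- apply: filterS h => z /= /(_ I) [] /eqP; rewrite -mulrA mulf_eq0.
  by rewrite gt_eqF ?expR_gt0//= => /eqP -> _.
Qed.

(** The conditional comparison at a fixed spread [u]: the factorized excess loss is integrated
    against the unnormalized conditional density [g], and the association inequality controls the
    exponential moment of [g] by [H]. *)
Lemma le_integral_linex a f c p q u :
    is_prob_density f -> MLR f -> a != 0 -> linex_c0u_well_defined a f ->
    0 <= p -> 0 <= q -> 0 < u -> linex_c0u a f u < c ->
    (\int[mu]_z (max_gap_density f p q z u)%:E < +oo)%E ->
  (\int[mu]_z ((linex a (z - linex_c0u a f u) + linex a (linex_c0u a f u - c)) *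
     max_gap_density f p q z u)%:E <=
   \int[mu]_z (linex a (z - c) * max_gap_density f p q z u)%:E)%E.
Proof.
move=> fd fMLR a0 wd p0 q0 u0 kc Goo; have H0 := linex_H_gt0 _ _ _ fd wd u0.
have [mf f0 _] := fd; have [iw iew D0] := wd u u0.
set k := linex_c0u a f u in kc *; pose g z := max_gap_density f p q z u.
pose H := linex_H a f u; have Hge0 : 0 <= H by exact: ltW.
have ek : expR (a * k) = H by rewrite /k /linex_c0u mulrA mulfV// mul1r lnK.
pose w z := f (z - u) * f z.
pose phi z := expR (a * z).
have g0 z : 0 <= g z by exact: max_gap_density_ge0.
have w0 z : 0 <= w z by rewrite mulr_ge0.
have phi0 z : 0 <= phi z by rewrite expR_ge0.
have mg : measurable_fun setT g.
  exact: (measurableT_comp (measurable_max_gap_density _ p q mf)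
    (pair2_measurable u)).
have mw : measurable_fun setT w by apply/measurable_EFinP; exact: measurable_int iw.
have mphi : measurable_fun setT phi.
  by apply: measurableT_comp => //; exact: measurable_funM.
pose D := \int[mu]_z w z; pose N := \int[mu]_z (expR (a * z) * f (z - u) * f z).
have DE : (\int[mu]_z (w z)%:E = D%:E)%E.
  by rewrite fineK// integrable_fin_num.
have NE : (\int[mu]_z (phi z * w z)%:E = N%:E)%E.
  rewrite /N /Rintegral fineK ?integrable_fin_num//.
  by under [RHS]eq_integral do rewrite -mulrA.
have G0 : (0 <= \int[mu]_z (g z)%:E)%E by apply: integral_ge0 => z _; rewrite lee_fin.
have E0 : (0 <= \int[mu]_z (phi z * g z)%:E)%E.
  by apply: integral_ge0 => z _; rewrite lee_fin mulr_ge0.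
pose G := fine (\int[mu]_z (g z)%:E).
have GE : (\int[mu]_z (g z)%:E = G%:E)%E by rewrite fineK// ge0_fin_numE.
have HE : H = N / D by [].
(* The ratio [g / w] is nonincreasing. Stated with [y - z], this serves both signs of [a]; only the
   monotonicity of [phi] depends on the sign. *)
have cross y z : (y - z) * (g y * w z - g z * w y) <= 0.
  have [zy|yz] := leP z y.
    rewrite mulr_ge0_le0 ?subr_ge0 ?subr_le0//; exact: MLR_max_gap_density.
  rewrite mulr_le0_ge0 ?subr_le0 ?subr_ge0//; first exact: ltW.
  by apply: MLR_max_gap_density => //; exact: ltW.
have mlinex c' : measurable_fun setT (fun z => linex a (z - c')).
  by apply: measurable_linex; exact: measurable_funB.
have intD (A : R -> R) b : measurable_fun setT A -> (forall z, 0 <= A z) -> 0 <= b ->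
    forall B : R -> R, measurable_fun setT B -> (forall z, 0 <= B z) ->
    (\int[mu]_z ((A z + b * B z) * g z)%:E =
     \int[mu]_z (A z * g z)%:E + b%:E * \int[mu]_z (B z * g z)%:E)%E.
  move=> mA A0 b0 B mB B0.
  have mBg : measurable_fun setT (fun z => (B z * g z)%:E).
    by apply/measurable_EFinP; exact: measurable_funM.
  rewrite -ge0_integralZl//; last by move=> z _; rewrite lee_fin mulr_ge0.
  rewrite -ge0_integralD//.
  - by apply: eq_integral => z _; rewrite -EFinM -EFinD; congr EFin; ring.
  - by move=> z _; rewrite lee_fin mulr_ge0.
  - by apply/measurable_EFinP; exact: measurable_funM.
  - by move=> z _; rewrite -EFinM lee_fin !mulr_ge0.
  - exact: measurable_funeM.
pose Ik := (\int[mu]_z ((linex a (z - k) + linex a (k - c)) * g z)%:E)%E.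
pose Ic := (\int[mu]_z (linex a (z - c) * g z)%:E)%E.
rewrite -[leLHS]/Ik -[leRHS]/Ic.
(* The factorization of the excess loss, arranged so that both sides are sums of
   nonnegative terms, once [al] is replaced by [- al] when a < 0. *)
have key z (al : R) : al = expR (- (a * k)) - expR (- (a * c)) ->
    linex a (z - c) + al * phi z =
    (linex a (z - k) + linex a (k - c)) + al * H.
  move=> ->; rewrite /linex /phi !mulrBr !expRD ek.
  have : H * expR (- (a * k)) = 1 by rewrite -ek -expRD subrr expR0.
  lra.
have lin0 z : 0 <= linex a (z - k) + linex a (k - c) by rewrite addr_ge0 ?linex_ge0.
have mlin : measurable_fun setT (fun z => linex a (z - k) + linex a (k - c)).
  exact: measurable_funD.
have HG (b : R) : 0 <= b ->
    (\int[mu]_z (b * H * g z)%:E = (b * H * G)%:E)%E.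
  move=> b0.
  under eq_integral do rewrite EFinM.
  rewrite ge0_integralZl//.
  - by rewrite GE -EFinM.
  - exact/measurable_EFinP.
  - by move=> z _; rewrite lee_fin.
  - by rewrite lee_fin mulr_ge0// ltW.
(* For [a < 0], [phi] is decreasing: association is applied with [g] and [w] exchanged and bounds
   the moment of [g] from below, possibly by an infinite moment. *)
have [an|ap] := ltP a 0.
- have : ((\int[mu]_z (phi z * w z)%:E) * (\int[mu]_z (g z)%:E) <=
     (\int[mu]_z (phi z * g z)%:E) * \int[mu]_z (w z)%:E)%E.
    apply: le_integral_cross_product => // y z.
    have [yz|zy|->] := ltgtP y z; last by rewrite subrr mul0r.
    + rewrite mulr_ge0_le0 ?subr_ge0//; first by rewrite ler_expR ler_nM2l ?ltW.
      have := cross y z; rewrite nmulr_rle0 ?subr_lt0// subr_ge0 subr_le0.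
      by rewrite mulrC [leRHS]mulrC.
    + rewrite mulr_le0_ge0 ?subr_le0//; first by rewrite ler_expR ler_nM2l ?ltW.
      have := cross y z; rewrite pmulr_rle0 ?subr_gt0// subr_ge0 subr_le0.
      by rewrite mulrC [leRHS]mulrC.
  rewrite NE GE DE => NGE.
  pose al := expR (- (a * c)) - expR (- (a * k)).
  have al0 : 0 <= al by rewrite subr_ge0 ler_expR lerN2 ler_nM2l// ltW.
  have HGE : ((H * G)%:E <= \int[mu]_z (phi z * g z)%:E)%E.
    move: NGE E0; case: (\int[mu]_z _)%E => [e| |]//; rewrite ?leey//.
    rewrite -!EFinM !lee_fin => NGe _.
    by rewrite HE mulrAC ler_pdivrMr.
  (* The term added to both sides is finite, hence cancellable even if [Ik] or [Ic] is infinite. *)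
  rewrite -(@leeD2rE _ (al * H * G)%:E)//.
  apply: (@le_trans _ _ (Ik + al%:E * \int[mu]_z (phi z * g z)%:E)%E).
    by rewrite leeD2l// -mulrA EFinM lee_wpmul2l// lee_fin.
  rewrite /Ik /Ic -intD// -HG// -ge0_integralD//; last 4 first.
  - by move=> z _; rewrite lee_fin mulr_ge0 ?linex_ge0.
  - by apply/measurable_EFinP; exact: (measurable_funM (mlinex c) mg).
  - by move=> z _; rewrite lee_fin; exact: mulr_ge0 (mulr_ge0 al0 Hge0) (g0 z).
  - by apply/measurable_EFinP; exact: measurable_funM.
  rewrite le_eqVlt; apply/orP; left; apply/eqP; apply: eq_integral => z _.
  rewrite -EFinD -mulrDl; congr ((_ * _)%:E).
  have := key z _ erefl; rewrite /al; lra.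
- have {}ap : 0 < a by rewrite lt_neqAle eq_sym a0.
  have : ((\int[mu]_z (phi z * g z)%:E) * (\int[mu]_z (w z)%:E) <=
     (\int[mu]_z (phi z * w z)%:E) * \int[mu]_z (g z)%:E)%E.
    apply: le_integral_cross_product => // y z.
    have [yz|zy|->] := ltgtP y z; last by rewrite subrr mul0r.
    + rewrite mulr_le0_ge0 ?subr_le0//; first by rewrite ler_expR ler_pM2l ?ltW.
      by have := cross y z; rewrite nmulr_rle0 ?subr_lt0// subr_ge0.
    + rewrite mulr_ge0_le0 ?subr_ge0//; first by rewrite ler_expR ler_pM2l ?ltW.
      by have := cross y z; rewrite pmulr_rle0 ?subr_gt0// subr_le0.
  rewrite NE GE DE => NGE.
  pose al := expR (- (a * k)) - expR (- (a * c)).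
  have al0 : 0 <= al by rewrite subr_ge0 ler_expR lerN2 ler_pM2l// ltW.
  (* For [a > 0] the moment is bounded from above. It cannot be infinite, because [D > 0] and
     [N * G] is finite. *)
  have HGE : (\int[mu]_z (phi z * g z)%:E <= (H * G)%:E)%E.
    move: NGE E0; case: (\int[mu]_z _)%E => [e| |]//.
      rewrite -!EFinM !lee_fin => NGe _.
      by rewrite HE mulrAC ler_pdivlMr.
    by rewrite gt0_mulye ?lte_fin.
  rewrite -(@leeD2rE _ (al * H * G)%:E)//.
  apply: (@le_trans _ _ (Ic + al%:E * \int[mu]_z (phi z * g z)%:E)%E); last first.
    by rewrite leeD2l// -mulrA EFinM lee_wpmul2l// lee_fin.
  rewrite /Ik /Ic -intD//; last by move=> z; exact: linex_ge0.
  rewrite -HG// -ge0_integralD//; last 4 first.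
  - by move=> z _; rewrite lee_fin mulr_ge0.
  - by apply/measurable_EFinP; exact: measurable_funM.
  - by move=> z _; rewrite lee_fin; exact: mulr_ge0 (mulr_ge0 al0 Hge0) (g0 z).
  - by apply/measurable_EFinP; exact: measurable_funM.
  rewrite le_eqVlt; apply/orP; left; apply/eqP; apply: eq_integral => z _.
  by rewrite -EFinD -mulrDl; congr ((_ * _)%:E); rewrite (key z _ erefl).
Qed.

End linex_estimation.

(** * The law of the sample, and of its maximum and spread *)

Section location.
Context {R : realType} {d : measure_display} {Omega : measurableType d}.
Notation mu := (@lebesgue_measure R).
Variables (f : R -> R) (P : R * R -> probability Omega R).
Variables (X1 X2 : {mfun Omega >-> R}).
Hypotheses (fd : is_prob_density f) (model : location_model f P X1 X2).

(** Independence says that the joint law agrees with the product of the marginals on rectangles,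
    hence everywhere. Tonelli then allows one density to be inserted at a time. *)
Lemma ge0_integral_location_model (theta : R * R) (F : R * R -> R) :
    measurable_fun setT F -> (forall x, 0 <= F x) ->
  (\int[P theta]_w (F (X1 w, X2 w))%:E =
   \int[mu]_x \int[mu]_y
     (F (x, y) * (f (x - theta.1)%R * f (y - theta.2)%R))%:E)%E.
Proof.
move=> mF F0; have [mf f0 _] := fd; have [indep dens1 dens2] := model theta.
have mfshift (c : R) : measurable_fun setT (fun x : R => f (x - c)).
  by apply: (measurableT_comp mf); exact: measurable_funB.
(* Lebesgue measure lives on measurableTypeR R, whose display differs from that
   of R: the laws of X1 and X2 are retyped accordingly. *)
pose toR (X : {mfun Omega >-> R}) : Omega -> measurableTypeR R := X.
have mtoR X : measurable_fun setT (toR X) by exact: (measurable_funPT X).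
pose mfunR X := isMeasurableFun.Build _ _ _ _ _ (mtoR X).
pose XR X : {mfun Omega >-> measurableTypeR R} := HB.pack (toR X) (mfunR X).
pose XX w := (XR X1 w, XR X2 w).
have mXX : measurable_fun setT XX by exact: measurable_fun_pair.
pose mfunXX := isMeasurableFun.Build _ _ _ _ _ mXX.
pose XXM : {mfun Omega >-> (measurableTypeR R * measurableTypeR R)%type} :=
  HB.pack XX mfunXX.
have mEF : measurable_fun setT (EFin \o F) by exact/measurable_EFinP.
have EF0 x : (0 <= (EFin \o F) x)%E by rewrite lee_fin.
transitivity (\int[distribution (P theta) XXM]_x (F x)%:E)%E.
  by rewrite (ge0_integral_distribution XXM).
transitivity (\int[distribution (P theta) (XR X1) \x
                   distribution (P theta) (XR X2)]_x (F x)%:E)%E.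
  apply: eq_measure_integral => A mA _; apply/esym.
  by apply: product_measure_unique => // B C mB mC; exact: indep.
rewrite (@fubini_tonelli1 _ _ (measurableTypeR R) (measurableTypeR R) R _ _
  (EFin \o F) mEF EF0)//= /fubini_F.
have mF2 x : measurable_fun setT (fun y => (F (x, y))%:E).
  by apply: (measurableT_comp mEF); exact: pair1_measurable.
rewrite (ge0_integral_density _ _ _ (distribution (P theta) (XR X1)) mu _
  (mfshift theta.1) _ dens1)//; last 2 first.
- exact: (@measurable_fun_fubini_tonelli_F _ _ (measurableTypeR R)
    (measurableTypeR R) R _ _ mEF EF0).
- by move=> x; apply: integral_ge0.
apply: eq_integral => x _.
rewrite (ge0_integral_density _ _ _ (distribution (P theta) (XR X2)) mu _
  (mfshift theta.2) _ dens2 _ (mF2 x))//; last by move=> y; rewrite lee_fin.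
rewrite -ge0_integralZr//; last 3 first.
- by apply: (emeasurable_funM (mF2 x)); apply/measurable_EFinP; exact: mfshift.
- by move=> y _; rewrite mule_ge0// lee_fin.
- by rewrite lee_fin.
by apply: eq_integral => y _; rewrite -!EFinM; congr EFin; ring.
Qed.

(** Identifies [max_gap_density] as a joint density, so that a risk becomes an integral over the
    spread of conditional integrals. *)
Lemma ge0_integral_max_spread (theta : R * R) (Psi : R * R -> R) :
    measurable_fun setT Psi -> (forall x, 0 <= Psi x) ->
  (\int[P theta]_w (Psi (maxp (X1 w, X2 w) - maxp theta, spread (X1 w, X2 w))%R)%:E =
   \int[mu]_(u in `]0%R, +oo[) \int[mu]_z
     (Psi (z, u) * max_gap_density f (maxp theta - theta.1)%R
                     (maxp theta - theta.2)%R z u)%:E)%E.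
Proof.
move=> mPsi Psi0; have [mf f0 _] := fd; set m := maxp theta.
have mmaxp : measurable_fun setT (@maxp R) by exact: measurable_maxr.
have mminp : measurable_fun setT (@minp R) by exact: measurable_minr.
pose F x := Psi (maxp x - m, spread x).
have F0 x : 0 <= F x by exact: Psi0.
have mF : measurable_fun setT F.
  by apply: (measurableT_comp mPsi); apply: measurable_fun_pair;
    exact: measurable_funB.
rewrite (ge0_integral_location_model theta F)//.
have mfshift (T := (R * R)%type) (h : T -> R) c : measurable_fun setT h ->
    measurable_fun setT (fun x => f (h x - c)).
  by move=> mh; apply: (measurableT_comp mf); exact: measurable_funB.
rewrite (ge0_integral_plane_max_gap
  (fun x => (F x * (f (x.1 - theta.1)%R * f (x.2 - theta.2)%R))%:E))/=; last 2 first.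
- apply/measurable_EFinP; apply: measurable_funM => //.
  by apply: measurable_funM; exact: mfshift.
- by move=> x; rewrite lee_fin; apply: mulr_ge0 => //; exact: mulr_ge0.
apply: eq_integral => u; rewrite inE/= in_itv/= andbT => u0.
have maxE z : maxp (z, z - u) = z /\ maxp (z - u, z) = z.
  by rewrite /maxp/=; split; [apply/max_idPl|apply/max_idPr]; rewrite gerBl ltW.
have minE z : minp (z, z - u) = z - u /\ minp (z - u, z) = z - u.
  by rewrite /minp/=; split; [apply/min_idPr|apply/min_idPl]; rewrite gerBl ltW.
have FE z : F (z, z - u) = Psi (z - m, u) /\ F (z - u, z) = Psi (z - m, u).
  have [h1 h2] := maxE z; have [h3 h4] := minE z.
  by rewrite /F /spread h1 h2 h3 h4 subKr.
pose h z := (Psi (z, u) *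
  max_gap_density f (m - theta.1) (m - theta.2) z u)%:E.
have mh : measurable_fun setT h.
  apply/measurable_EFinP; apply: measurable_funM.
    by apply: (measurableT_comp mPsi); exact: pair2_measurable.
  exact: (measurableT_comp (measurable_max_gap_density _ _ _ mf)
    (pair2_measurable u)).
(* Translation by [- m] recentres the maximum at the larger parameter. *)
rewrite -[RHS](ge0_integral_lebesgueD (- m) h)//; last first.
  by move=> z; rewrite lee_fin mulr_ge0// max_gap_density_ge0.
apply: eq_integral => z _; have [-> ->] := FE z.
rewrite -EFinD /h /max_gap_density -mulrDr; congr (_ * _)%:E.
congr (f _ * f _ + f _ * f _); ring.
Qed.


(** * Quantitative risk reduction *)

Hypotheses (fMLR : MLR f).
Variable a : R.
Hypotheses (a_neq0 : a != 0) (c0u_wd : linex_c0u_well_defined a f).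

Let measurable_spread : measurable_fun setT (fun w => spread (X1 w, X2 w)).
Proof.
by apply: measurable_funB; [exact: measurable_maxr|exact: measurable_minr].
Qed.

Let measurable_maxp : measurable_fun setT (fun w => maxp (X1 w, X2 w)).
Proof. exact: measurable_maxr. Qed.

(* Lower bound for the conditional risk reduction, given spread u, achieved by
   replacing c with min c (linex_c0u a f u). *)
Definition linex_gain (c u : R) : R :=
  if linex_c0u a f u < c then linex a (linex_c0u a f u - c) else 0.

Lemma linex_gain_ge0 c u : 0 <= linex_gain c u.
Proof. by rewrite /linex_gain; case: ifPn => // _; exact: linex_ge0. Qed.

Lemma linex_gain_gt0 c u : linex_c0u a f u < c -> 0 < linex_gain c u.
Proof.
by move=> uc; rewrite /linex_gain uc linex_gt0// subr_eq0 lt_eqF.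
Qed.

Lemma measurable_linex_gain c : measurable_fun setT (linex_gain c).
Proof.
have mc0u := measurable_linex_c0u a f fd.
apply: measurable_fun_ifT => //; first exact: measurable_fun_ltr.
by apply: measurable_linex; exact: measurable_funB.
Qed.

(** The conditional comparison integrated over the spread. The gain is added on the left rather than
    obtained as a difference of risks, so that nothing infinite is ever subtracted. *)
Lemma risk_delta_STD_gain theta :
  (risk (linex a) P X1 X2 theta (delta_ST a f) +
   \int[P theta]_w (linex_gain (linex_c0 a f) (spread (X1 w, X2 w)))%:E <=
   risk (linex a) P X1 X2 theta (delta_c0 a f))%E.
Proof.
have [mf f0 _] := fd; set c := linex_c0 a f.
have mc0u := measurable_linex_c0u a f fd; have mgain := measurable_linex_gain c.
pose m := maxp theta; pose p := m - theta.1; pose q := m - theta.2.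
have p0 : 0 <= p by rewrite subr_ge0 le_max lexx.
have q0 : 0 <= q by rewrite subr_ge0 le_max lexx orbT.
pose PsiST (x : R * R) :=
  linex a (x.1 - Num.min c (linex_c0u a f x.2)) + linex_gain c x.2.
pose Psi0 (x : R * R) := linex a (x.1 - c).
have mPsiST : measurable_fun setT PsiST.
  apply: measurable_funD; last exact: measurableT_comp.
  apply: measurable_linex; apply: measurable_funB => //.
  by apply: measurable_minr => //; exact: measurableT_comp.
have mPsi0 : measurable_fun setT Psi0.
  by apply: measurable_linex; exact: measurable_funB.
have PsiST0 x : 0 <= PsiST x by rewrite addr_ge0 ?linex_ge0 ?linex_gain_ge0.
have Psi00 x : 0 <= Psi0 x by exact: linex_ge0.
rewrite /risk unlock -ge0_integralD//; last 4 first.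
- by move=> w _; rewrite lee_fin linex_ge0.
- apply/measurable_EFinP; apply: measurable_linex; apply: measurable_funB => //.
  apply: measurable_funB => //; apply: measurable_minr => //.
  exact: (measurableT_comp mc0u measurable_spread).
- by move=> w _; rewrite lee_fin linex_gain_ge0.
- by apply/measurable_EFinP; exact: (measurableT_comp mgain measurable_spread).
under eq_integral => w _.
  rewrite -EFinD (_ : linex _ _ + linex_gain _ _ =
    PsiST (maxp (X1 w, X2 w) - m, spread (X1 w, X2 w))).
    over.
  by rewrite /PsiST /delta_ST/=; congr (linex _ _ + _); exact: addrAC.
under [leRHS]eq_integral => w _.
  rewrite (_ : linex _ _ = Psi0 (maxp (X1 w, X2 w) - m, spread (X1 w, X2 w))).
    over.
  by rewrite /Psi0 /delta_c0/=; congr linex; exact: addrAC.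
rewrite !ge0_integral_max_spread//.
pose g z u := max_gap_density f p q z u.
have g0 z u : 0 <= g z u by exact: max_gap_density_ge0.
have mg : measurable_fun setT (fun zu : R * R => g zu.1 zu.2).
  exact: measurable_max_gap_density.
have mI (Psi : R * R -> R) : measurable_fun setT Psi -> (forall x, 0 <= Psi x) ->
    measurable_fun setT (fun u => \int[mu]_z (Psi (z, u) * g z u)%:E)%E.
  move=> mPsi Psi_ge0; apply: (@measurable_fun_fubini_tonelli_G _ _ _ _ _ mu
    (fun zu : R * R => (Psi zu * g zu.1 zu.2)%:E)).
    by apply/measurable_EFinP; exact: measurable_funM.
  by move=> x; rewrite lee_fin mulr_ge0.
have I0 (Psi : R * R -> R) : (forall x, 0 <= Psi x) ->
    forall u, (0 <= \int[mu]_z (Psi (z, u) * g z u)%:E)%E.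
  by move=> Psi_ge0 u; apply: integral_ge0 => z _; rewrite lee_fin mulr_ge0.
(* Total mass one, from the constant function 1. It makes the inner integral finite for almost every
   [u], as [le_integral_linex] requires. *)
have intg : (\int[mu]_(u in `]0%R, +oo[) \int[mu]_z (g z u)%:E = 1)%E.
  transitivity (\int[P theta]_w
      (cst 1 (maxp (X1 w, X2 w) - m, spread (X1 w, X2 w))%R)%:E)%E.
    rewrite ge0_integral_max_spread//; apply: eq_integral => u _.
    by apply: eq_integral => z _; rewrite /= mul1r.
  by rewrite /= integral_cst// [X in (_ * X)%E]probability_setT mule1.
have Ig0 u : (0 <= \int[mu]_z (g z u)%:E)%E.
  by apply: integral_ge0 => z _; rewrite lee_fin.
have /integrable_ae gfin : mu.-integrable `]0, +oo[ (fun u => \int[mu]_z (g z u)%:E)%E.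
  apply/integrableP; split.
    apply: measurable_funTS.
    have := mI (cst 1) (@measurable_cst _ _ _ _ _ _) (fun=> ler01).
    by under eq_fun do under eq_integral do rewrite mul1r.
  by under eq_integral do rewrite gee0_abs//; rewrite intg ltry.
apply: ae_ge0_le_integral => //.
- by move=> u _; exact: I0.
- by apply: measurable_funTS; exact: mI.
- by move=> u _; exact: I0.
- by apply: measurable_funTS; exact: mI.
apply: filterS (gfin (measurable_itv _)) => u + u0 => /(_ u0) Gfin.
move: u0; rewrite /= in_itv/= andbT => u0.
(* If [c] does not exceed [linex_c0u a f u], the minimum is [c], the gain is 0 and both integrands
   coincide. *)
rewrite /PsiST /Psi0 /linex_gain/=; case: ltP => [kc|_].
  by apply: le_integral_linex => //; rewrite -ge0_fin_numE.
by under eq_integral do rewrite addr0.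
Qed.

End location.

(** * Domination for every parameter, strict for some parameter *)

Theorem theorem3p2 (R : realType) (d : measure_display)
    (Omega : measurableType d) (P : R * R -> probability Omega R)
    (X1 X2 : {mfun Omega >-> R}) (f : R -> R) (a : R)
    (f_density : is_prob_density f)
    (model : location_model f P X1 X2)
    (a_neq0 : a != 0)
    (f_MLR : MLR f)
    (loss_finite : linex_loss_finite a f)
    (c0u_well_defined : linex_c0u_well_defined a f)
    (risk_finite : forall theta : R * R,
       (risk (linex a) P X1 X2 theta (delta_c0 a f) < +oo)%E /\
       (risk (linex a) P X1 X2 theta (delta_ST a f) < +oo)%E)
    (prob_neq0 : exists theta : R * R,
       P theta [set w | a^-1 * ln (linex_H a f (spread (X1 w, X2 w)))
                        < linex_c0 a f] <> 0%E) :
  improves_upon (linex a) P X1 X2 (delta_ST a f) (delta_c0 a f).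
Proof.
have gap := risk_delta_STD_gain f P X1 X2 f_density model f_MLR a a_neq0
  c0u_well_defined.
set c := linex_c0 a f in prob_neq0 gap.
have gain0 theta :
    (0 <= \int[P theta]_w (linex_gain f a c (spread (X1 w, X2 w)))%:E)%E.
  by apply: integral_ge0 => w _; rewrite lee_fin linex_gain_ge0.
have riskST0 theta : (0 <= risk (linex a) P X1 X2 theta (delta_ST a f))%E.
  by apply: expectation_ge0 => w; exact: linex_ge0.
split=> [theta|]; first by apply: le_trans (gap theta); rewrite leeDl.
have [theta Pneq0] := prob_neq0; exists theta.
(* Adding a positive expected gain to the finite risk of [delta_ST] increases it strictly. *)
apply: lt_le_trans (gap theta); rewrite lteDl; last first.
  by rewrite ge0_fin_numE//; have [] := risk_finite theta.
(* A zero expected gain would make the gain vanish almost surely; it is positive on the event of the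
   hypothesis, which would then be null. *)
rewrite lt0e gain0 andbT; apply/eqP => int0; apply: Pneq0.
have mspread : measurable_fun setT (fun w => spread (X1 w, X2 w)).
  by apply: measurable_funB; [exact: measurable_maxr|exact: measurable_minr].
have mgain : measurable_fun setT (fun w => linex_gain f a c (spread (X1 w, X2 w))).
  exact: (measurableT_comp (measurable_linex_gain f f_density a c) mspread).
have /ae_eq_integral_abs : (\int[P theta]_w
    `|(linex_gain f a c (spread (X1 w, X2 w)))%:E| = 0)%E.
  by under eq_integral do rewrite gee0_abs ?lee_fin ?linex_gain_ge0//.
case/(_ measurableT); first exact/measurable_EFinP.
move=> N [mN N0 subN]; apply: (subset_measure0 _ mN _ N0).
  rewrite -[X in measurable X]setTI.
  apply: (measurable_fun_ltr (f := fun w => linex_c0u a f (spread (X1 w, X2 w)))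
    (g := cst c)) => //.
  exact: (measurableT_comp (measurable_linex_c0u a f f_density) mspread).
move=> w /= wc; apply: subN => /= /(_ I) /eqP; rewrite eqe gt_eqF//.
exact: linex_gain_gt0.
Qed.
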